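(* In general no ordering with respect to the mean squared error exists between TD($\lambda$) and the first-visit Monte Carlo (MC) estimator. More precisely: (a) there exist a Markov Reward Process, a state $s$ and a number $n$ of observed i.i.d. paths for which, for all choices of learning rates in $[0,1]$ whose first element is $1$, the MC estimator of $V_s$ has strictly smaller mean squared error than the TD(0) estimator of $V_s$, and for which the mean squared error of the MC estimator is at most that of the TD($\lambda$) estimator for every $\lambda$; (b) there exist a Markov Reward Process, a state $s$ and a number $n$ of observed i.i.d. paths for which the TD(0) estimator of $V_s$ (with learning rates $\alpha_k=1/k$) has strictly smaller mean squared error than the MC estimator of $V_s$.
   Context: A Markov Reward Process (MRP) has a finite state space, starting probabilities $p_i$, transition probabilities $p_{ij}$, random real rewards $R_{ij}$ received on a transition $i\to j$, and a discount $\gamma\in(0,1]$. Terminal states have no outgoing transitions, value $0$ and value estimate $0$. The value is $V_i=\sum_j p_{ij}(\mathbb E[R_{ij}]+\gamma V_j)$. The MRP is acyclic if no path of positive probability contains a state twice; the MRPs in (a) and (b) can be taken acyclic. The sample consists of $n$ i.i.d. paths with their rewards, observed one after another. The mean squared error of an estimator $T$ of $V_s$ is $\mathbb E[(T-V_s)^2]$; the estimate of a state that is never visited is $0$. The first-visit Monte Carlo estimator of $V_s$ is the average, over all observed paths that visit $s$, of the discounted sum of rewards following the first visit to $s$ in that path. TD($\lambda$), $\lambda\in[0,1]$, for an acyclic MRP: each state $s$ has a sequence of learning rates $\alpha_1,\alpha_2,\ldots\in[0,1]$ with $\alpha_1=1$ (the sequences of different states may differ). When a path visits $s$ and this is the $k$-th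 visit to $s$ overall, let $s=\pi_1,\pi_2,\pi_3,\ldots$ be the part of the path from $s$ on and let $R_i$ be the reward received on the transition $\pi_i\to\pi_{i+1}$. The estimate is updated by $$\bar V_s\leftarrow(1-\alpha_k)\bar V_s+\alpha_k\Big(\sum_{i\ge1}(\gamma\lambda)^{i-1}R_i+\gamma(1-\lambda)\sum_{i\ge2}(\gamma\lambda)^{i-2}\bar V_{\pi_i}\Big),$$ where, if the estimate of some successor $\pi_i$ in the path has not yet seen any example, that estimate is first updated with the current path. For $\lambda=0$ this is the rule $\bar V_s\leftarrow\bar V_s+\alpha_k(R_1+\gamma\bar V_{\pi_2}-\bar V_s)$. *)

(* Defs.v *)
From HB Require Import structures.
From mathcomp Require Import all_boot all_order all_algebra.
From mathcomp Require Import all_classical all_reals all_analysis.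

Set Implicit Arguments.
Unset Strict Implicit.
Unset Printing Implicit Defensive.

Import Order.TTheory GRing.Theory Num.Theory.

Local Open Scope classical_set_scope.
Local Open Scope ring_scope.

(* A state with [trans i j = 0] for all [j] is terminal; every other state has
   outgoing probabilities summing to 1.  [reward i j] is the law of the random
   reward R_ij. *)
Record mrp (R : realType) (S : finType) := Mrp {
  start : S -> R ;
  trans : S -> S -> R ;
  reward : S -> S -> probability (measurableTypeR R) R ;
  disc : R ;
  start_ge0 : forall i, 0 <= start i ;
  start_sum1 : \sum_i start i = 1 ;
  trans_ge0 : forall i j, 0 <= trans i j ;
  trans_sum : forall i,
    \sum_j trans i j = 1 \/ (forall j, trans i j = 0) ;
  reward_integrable : forall i j,
    (reward i j).-integrable [set: measurableTypeR R] (fun x : R => x%:E) ;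
  disc_bounds : 0 < disc <= 1
}.

Section Mrp.
Context (R : realType) (S : finType).
Implicit Types (M : mrp R S) (i j s x y : S) (w : seq S).

Definition terminal M i : bool := [forall j, trans M i j == 0].

Definition reward_mean M i j : R :=
  fine ('E_(reward M i j)[fun x : R => x])%E.

(* On terminal states the sum is 0.  For an acyclic process the equation has
   exactly one solution. *)
Definition is_value M (V : S -> R) : Prop :=
  forall i, V i = \sum_j trans M i j * (reward_mean M i j + disc M * V j).

Definition acyclic M : Prop :=
  forall i w, path (fun x y => 0 < trans M x y) i w -> uniq (i :: w).

(* The probability that a path continues from [i] exactly through the states
   [w], ending in a terminal state, with its t-th reward in [B t] for every
   t < size w. *)
Fixpoint path_law_from M i w (B : nat -> set R) : \bar R :=
  if w is j :: w' then
    ((trans M i j)%:E * reward M i j (B 0%N) *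
       path_law_from M j w' (fun t => B t.+1))%E
  else (terminal M i)%:R%:E.

Definition path_law M w (B : nat -> set R) : \bar R :=
  if w is i :: w' then ((start M i)%:E * path_law_from M i w' B)%E else 0%E.

(* An observed path: the complete list of its states, from the starting state
   to the terminal state, and its rewards; the t-th reward (from t = 0) belongs
   to the transition from the t-th to the (t+1)-th state, and only the indices
   t < (number of states) - 1 are meaningful. *)
Definition episode : Type := (seq S * (nat -> R))%type.

End Mrp.

Section Sample.
Context (R : realType) (S : finType) (d : measure_display)
  (Omega : measurableType d).

Definition path_event (X : Omega -> seq S) (Y : nat -> Omega -> R)
    (w : seq S) (B : nat -> set R) : set Omega :=
  [set om | X om = w /\
     forall t : nat, (t < (size w).-1)%N -> B t (Y t om)].

(* [X k] and [Y k] are the states and the rewards of the k-th observed path;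
   the n paths with their rewards are independent, with law [path_law M].
   The events [path_event] form, up to the empty set, a pi-system generating
   the sigma-algebra of a path with its rewards. *)
Record iid_sample (M : mrp R S) (n : nat) (P : probability Omega R)
    (X : 'I_n -> Omega -> seq S) (Y : 'I_n -> nat -> Omega -> R) : Prop :=
  IidSample {
  sample_path_measurable : forall k w, measurable [set om | X k om = w] ;
  sample_reward_measurable : forall k t, measurable_fun [set: Omega] (Y k t) ;
  sample_law : forall k w (B : nat -> set R),
    (forall t, measurable (B t)) ->
    P (path_event (X k) (Y k) w B) = path_law M w B ;
  sample_indep : forall (J : {set 'I_n}) (w : 'I_n -> seq S)
      (B : 'I_n -> nat -> set R),
    (forall k t, measurable (B k t)) ->
    P (\bigcap_(k in [set k | k \in J]) path_event (X k) (Y k) (w k) (B k)) =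
    (\prod_(k in J) P (path_event (X k) (Y k) (w k) (B k)))%E
}.

Definition observed (n : nat) (X : 'I_n -> Omega -> seq S)
    (Y : 'I_n -> nat -> Omega -> R) (om : Omega) : seq (episode R S) :=
  [seq (X k om, fun t => Y k t om) | k <- enum 'I_n].

Definition mse (P : probability Omega R) (T : Omega -> R) (v : R) : \bar R :=
  ('E_P[fun om => ((T om - v) ^+ 2)%R])%E.

End Sample.

(* The law of a sample of [n] paths is realised on some probability space. *)
Definition sample_exists (R : realType) (S : finType) (M : mrp R S) (n : nat)
    : Prop :=
  exists (d : measure_display) (Omega : measurableType d)
    (P : probability Omega R) (X : 'I_n -> Omega -> seq S)
    (Y : 'I_n -> nat -> Omega -> R), iid_sample M P X Y.

Section Estimators.
Context (R : realType) (S : finType).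
Implicit Types (g l : R) (s x : S) (e : episode R S).

Definition first_visit_return g s e : R :=
  \sum_(index s e.1 <= t < (size e.1).-1) g ^+ (t - index s e.1) * e.2 t.

(* The average over no paths is 0, since 0^-1 = 0. *)
Definition mc g s (obs : seq (episode R S)) : R :=
  (\sum_(e <- obs | s \in e.1) first_visit_return g s e) /
  (count (fun e => s \in e.1) obs)%:R.

(* [a s k] is the learning rate alpha_k of [s]; [a s 0] is never used. *)
Definition learning_rates (a : S -> nat -> R) : Prop :=
  forall s, a s 1%N = 1 /\ forall k, (0 < k)%N -> 0 <= a s k <= 1.

Definition harmonic_rates : S -> nat -> R := fun _ k => k%:R^-1.

(* The target for the first state of a path whose remaining states are [w] and
   whose rewards are [r]: the i-th state of [w] and the i-th reward (from
   i = 0) are pi_{i+2} and R_{i+1}. *)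
Definition td_target g l (V : S -> R) (w : seq S) (r : nat -> R) : R :=
  \sum_(0 <= i < size w) (g * l) ^+ i * r i +
  g * (1 - l) * \sum_(0 <= i < size w) (g * l) ^+ i * (map V w)`_i.

(* The estimates after one path, from the estimates [V] and the numbers of
   visits [N] before it.  A state is updated with the estimates its successors
   had before the path, except that a successor never seen before is updated
   with the current path first.  Each state of the path is updated once; the
   path is assumed free of repetitions, as in an acyclic process. *)
Fixpoint td_path g l (a : S -> nat -> R) (V : S -> R) (N : S -> nat)
    (w : seq S) (r : nat -> R) : S -> R :=
  if w is s :: w' then
    let V' := td_path g l a V N w' (fun t => r t.+1) in
    let U := fun x => if N x == 0%N then V' x else V x in
    let k := (N s).+1 in
    fun x => if x == s
             then (1 - a s k) * V s + a s k * td_target g l U w' r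
             else V' x
  else V.

(* The state of the learner: the current estimates and the visit counts. *)
Definition td_step g l (a : S -> nat -> R) (st : (S -> R) * (S -> nat)) e
    : (S -> R) * (S -> nat) :=
  (td_path g l a st.1 st.2 e.1 e.2, fun x => (st.2 x + (x \in e.1))%N).

Definition td g l (a : S -> nat -> R) s (obs : seq (episode R S)) : R :=
  (foldl (td_step g l a) (fun=> 0, fun=> 0%N) obs).1 s.

End Estimators.

(* Main.v *)
Require Import Defs.
From HB Require Import structures.
From mathcomp Require Import all_boot all_order all_algebra.
From mathcomp Require Import all_classical all_reals all_analysis.
From mathcomp Require Import measurable_realfun.
From mathcomp Require Import ring lra.

Set Implicit Arguments.
Unset Strict Implicit.
Unset Printing Implicit Defensive.

Import Order.TTheory GRing.Theory Num.Theory.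

Local Open Scope classical_set_scope.
Local Open Scope ring_scope.

(* Both parts use a process s -> x -> (t or t') with rewards +1 and -1 on the two
   equally likely last transitions, 0 elsewhere, discount 1 and all values 0; a
   path starts in s with probability p and in x otherwise.
   (a) p = 1, n = 2.  With first returns G1 and G2, MC is (G1 + G2) / 2, while
   TD(l) bootstraps on the estimate G1 of x and ends at (1 - u) G1 + u G2 with
   u = l alpha_2; the error (1 - u)^2 + u^2 is at least 1/2, and is 1 for l = 0.
   (b) p = 1/4, n = 3.  TD(0) profits from the paths that start in x, which MC
   ignores; the errors are 1079/2304 and 191/384. *)

(** * Integrals of functions constant on the cells of a finite partition *)

Section IntegralFinitePartition.
Context d (T : measurableType d) (R : realType) (mu : {measure set T -> \bar R}).
Local Open Scope ereal_scope.
Import HBNNSimple.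

(** The integral is a supremum over simple functions, so measurability of [f] and [g] is never
    called for: a simple function below [f], cut off outside [U], keeps its integral and lies below
    [g]. *)
Lemma ge0_le_integral_nonmeasurable (f g : T -> \bar R) (U : set T) :
  measurable U -> mu (~` U) = 0 -> (forall x, 0 <= f x) -> (forall x, 0 <= g x) ->
  (forall x, U x -> f x <= g x) -> \int[mu]_x f x <= \int[mu]_x g x.
Proof.
move=> mU U0 f0 g0 fg; rewrite !ge0_integralTE//.
apply: ge_ereal_sup => _ [h /= hf <-].
have -> : sintegral mu h = sintegral mu (h \_ U).
  rewrite -integral_nnsfun// -[in LHS](patch_setT (cst 0%R) h) -integral_nnsfun//.
  rewrite (ge0_negligible_integral _ _ _ _ U0)//.
  - by rewrite setTD setCK.
  - exact: measurableC.
  - by apply/measurable_EFinP.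
  - by move=> x _; rewrite lee_fin.
apply: ereal_sup_ubound.
exists (proj_nnsfun h mU).
  move=> x /=; rewrite mindicE.
  have [Ux|Ux] := pselect (U x).
    by rewrite mem_set// mulr1 (le_trans (hf x))// fg.
  by rewrite memNset// mulr0.
by rewrite mrestrict.
Qed.

(** Off the cells, a null set, [f] is arbitrary and perhaps not measurable; comparison in both
    directions with the simple function [g] gives the integral. *)
Lemma ge0_integral_finite_partition (I : finType) (E : I -> set T) (c : I -> R)
    (f : T -> R) :
  mu setT = 1 ->
  (forall i, measurable (E i)) -> trivIset setT E -> \sum_i mu (E i) = 1 ->
  (forall x, 0 <= f x)%R -> (forall i, 0 <= c i)%R ->
  (forall i x, E i x -> f x = c i) ->
  \int[mu]_x (f x)%:E = \sum_i (c i)%:E * mu (E i).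
Proof.
move=> muT mE tE sE f0 c0 fc.
pose U := \big[setU/set0]_(i in I) E i.
have mU : measurable U by exact: bigsetU_measurable.
have muU : mu U = 1.
  rewrite /U big_enum_val measure_bigsetU_ord//.
    by rewrite -(big_enum_val (A := I) (fun i => mu (E i))).
  move=> i j _ _ Eij; apply: enum_val_inj; exact: tE.
have UC : mu (~` U) = 0.
  have muTU : mu setT = mu U + mu (~` U).
    by rewrite -measureU ?setUv ?setICr//; exact: measurableC.
  by move: muTU; rewrite muT muU; case: (mu _) => [r||]// [] r0; congr EFin; lra.
pose g x := (\sum_i (c i * \1_(E i) x))%R.
have g0 x : (0 <= g x)%R by apply: sumr_ge0 => i _; rewrite mulr_ge0.
have fg x : U x -> f x = g x.
  rewrite /U -bigcup_pred => -[i _ Ex].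
  rewrite /g (bigD1 i)//= big1 ?addr0 => [|j ji].
    by rewrite indicE mem_set// mulr1 (fc i).
  rewrite indicE memNset ?mulr0// => Ejx.
  by move/eqP: ji; apply; apply: tE => //; exists x.
have -> : \int[mu]_x (f x)%:E = \int[mu]_x (g x)%:E.
  apply/eqP; rewrite eq_le; apply/andP; split;
  by apply: (ge0_le_integral_nonmeasurable mU UC) => x; rewrite ?lee_fin// => /fg ->.
under eq_integral do rewrite -sumEFin.
rewrite ge0_integral_sum//.
- apply: eq_bigr => i _.
  rewrite (integralZl_indic measurableT (fun=> E i))//.
    by rewrite integral_indic// setIT.
  by rewrite ltNge c0.
- by move=> i; apply/measurable_EFinP; exact: measurable_funM.
- by move=> i x _; rewrite lee_fin mulr_ge0.
Qed.
End IntegralFinitePartition.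

Lemma big_option (V : nmodType) (I : finType) (F : option I -> V) :
  \sum_i F i = F None + \sum_i F (Some i).
Proof.
rewrite (bigD1 None)//=; congr (_ + _).
by rewrite (reindex_omap Some id) => [|[]]//=; apply: eq_bigl => i; rewrite eqxx.
Qed.

Lemma dirac_integrable (R : realType) (a : R) :
  (\d_(a : measurableTypeR R)).-integrable
    [set: measurableTypeR R] (fun x : R => x%:E).
Proof.
apply/integrableP; split; first exact: EFin_measurable.
rewrite integral_dirac//; first by rewrite diracT mul1e ltry.
by apply: measurableT_comp => //; exact: EFin_measurable.
Qed.

(** * The process and the law of its paths *)

Section ForkProcess.
Context (R : realType) (p : R) (p01 : 0 <= p <= 1).

(* [None], [Some None], [Some (Some true)], [Some (Some false)] are s, x, t, t'. *)
Definition fork_state : finType := option (option bool).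

Definition branch_reward (c : bool) : R := if c then 1 else -1.

Definition fork_start (i : fork_state) : R :=
  match i with None => p | Some None => 1 - p | _ => 0 end.

Definition fork_trans (i j : fork_state) : R :=
  match i, j with
  | None, Some None => 1
  | Some None, Some (Some _) => 2^-1
  | _, _ => 0
  end.

Definition fork_reward (i j : fork_state) : R :=
  match i, j with Some None, Some (Some c) => branch_reward c | _, _ => 0 end.

Lemma fork_start_ge0 i : 0 <= fork_start i.
Proof. by case/andP: p01 => p0 p1; case: i => [[c|]|] //=; lra. Qed.

Lemma fork_start_sum1 : \sum_i fork_start i = 1.
Proof. by rewrite !big_option big_bool/=; lra. Qed.

Lemma fork_trans_ge0 i j : 0 <= fork_trans i j.
Proof. by case: i j => [[c|]|] [[c'|]|]//=; rewrite invr_ge0. Qed.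

Lemma fork_trans_sum i :
  \sum_j fork_trans i j = 1 \/ (forall j, fork_trans i j = 0).
Proof.
case: i => [[c|]|]; first by right.
  by left; rewrite !big_option big_bool/=; lra.
by left; rewrite !big_option big_bool/=; lra.
Qed.

Definition fork_mrp : mrp R fork_state :=
  @Mrp R fork_state fork_start fork_trans (fun i j => \d_(fork_reward i j : measurableTypeR R)) 1
    fork_start_ge0 fork_start_sum1 fork_trans_ge0 fork_trans_sum
    (fun i j => dirac_integrable (fork_reward i j))
    (introT andP (conj ltr01 (lexx 1))).

Lemma fork_acyclic : acyclic fork_mrp.
Proof.
(* Each transition of positive probability raises the rank, so no state recurs. *)
pose rank (i : fork_state) : nat :=
  match i with None => 0 | Some None => 1 | _ => 2 end.
move=> i w iw; apply: (@map_uniq _ _ rank).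
apply: (sorted_uniq ltn_trans ltnn).
rewrite /= path_map; apply: sub_path iw => x y.
by case: x y => [[c|]|] [[c'|]|]//=; rewrite /fork_trans/= ltxx.
Qed.

Lemma fork_reward_mean i j : reward_mean fork_mrp i j = fork_reward i j.
Proof. by rewrite /reward_mean unlock integral_dirac// diracT mul1e. Qed.

Lemma fork_value : is_value fork_mrp (fun=> 0).
Proof.
move=> i; rewrite !big_option big_bool !fork_reward_mean/=.
by case: i => [[c|]|] /=; lra.
Qed.

(* A path is coded by whether it starts in s and by the
   branch [c] taken. *)
Definition route (e : bool * bool) : seq fork_state :=
  if e.1 then [:: None; Some None; Some (Some e.2)]
  else [:: Some None; Some (Some e.2)].

Definition route_reward (e : bool * bool) (t : nat) : R :=
  if e.1 && (t == 0%N) then 0 else branch_reward e.2.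

Definition route_prob (e : bool * bool) : R := (if e.1 then p else 1 - p) / 2.

Lemma route_prob_ge0 e : 0 <= route_prob e.
Proof. by case/andP: p01 => p0 p1; rewrite /route_prob; case: e.1; lra. Qed.

Lemma route_prob_sum1 : \sum_e route_prob e = 1.
Proof.
rewrite -(pair_bigA _ (fun b c => route_prob (b, c)))/= !big_bool /route_prob/=; lra.
Qed.

Lemma route_inj : injective route.
Proof. by move=> [[] c] [[] c'] []// ->. Qed.

Definition route_event (w : seq fork_state) (B : nat -> set R) (e : bool * bool) : bool :=
  (route e == w) && `[< forall t, (t < (size w).-1)%N -> B t (route_reward e t) >].

(** Rewards are determined by the path, so the law has at most four atoms, one per code; as [route]
    is injective, at most one of them contributes for a given [w]. *)
Lemma fork_path_law w B :
  path_law fork_mrp w B = (\sum_(e | route_event w B e) route_prob e)%:E.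
Proof.
have terminalE i : terminal fork_mrp i = (if i is Some (Some _) then true else false).
  case: i => [[c|]|]; apply/forallP => /=.
  - by move=> j; rewrite eqxx.
  - by move=> /(_ (Some (Some true))); rewrite invr_eq0 pnatr_eq0.
  - by move=> /(_ (Some None)); rewrite oner_eq0.
(* The law of the rest of a path is computed backwards: from t or t', then x, then s. *)
have law0 c u C : path_law_from fork_mrp (Some (Some c)) u C =
    ((u == [::])%:R)%:E.
  by case: u => [|j u]/=; rewrite ?terminalE// !mul0e.
have law1 u C : path_law_from fork_mrp (Some None) u C =
    (if u is [:: Some (Some c)] then 2^-1 * (branch_reward c \in C 0%N)%:R else 0)%:E.
  case: u => [|[[c|]|] u]/=; rewrite ?terminalE// ?mul0e// law0.
  by rewrite diracE -!EFinM; case: u => [|? ?] /=; rewrite (mulr1, mulr0).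
have law2 u C : path_law_from fork_mrp None u C =
    (if u is [:: Some None; Some (Some c)] then
      (0 \in C 0%N)%:R * (2^-1 * (branch_reward c \in C 1%N)%:R) else 0)%:E.
  case: u => [|[[c|]|] u]/=; rewrite ?terminalE// ?mul0e// law1.
  rewrite mul1e diracE -!EFinM; congr (_%:E).
  by case: u => [|[[c|]|] [|? ?]] //=; rewrite mulr0.
rewrite big_mkcond/=.
(* If [w] is no route, both sides vanish; otherwise only the term of its code survives. *)
have [e /eqP <-|wN] := pickP (fun e => route e == w); last first.
  rewrite big1 => [|e _]; last by rewrite /route_event wN.
  case: w wN => [|[[c|]|] w] wN //=; first by rewrite law0 mul0e.
    rewrite law1; case: w wN => [|[[c|]|] [|? ?]] wN; rewrite ?mule0//.
    by have := wN (false, c); rewrite eqxx.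
  rewrite law2; case: w wN => [|[[c|]|] [|[[c'|]|] [|? ?]]] wN; rewrite ?mule0//.
  by have := wN (true, c'); rewrite eqxx.
rewrite (bigD1 e)//= big1 ?addr0 => [|e' e'e]; last first.
  by rewrite /route_event (inj_eq route_inj) (negbTE e'e).
have {}in_asboolE (A : set R) y : (y \in A) = `[< A y >] by apply/idP/asboolP; rewrite inE.
rewrite /route_event eqxx/= /route_prob; case: e => [[] c].
- rewrite [LHS](_ : _ = (p%:E * path_law_from fork_mrp None [:: Some None; Some (Some c)] B)%E)//.
  rewrite law2 !in_asboolE -EFinM /=; congr EFin.
  have -> : `[< forall t, (t < 2)%N -> B t (route_reward (true, c) t) >] =
      `[< B 0%N 0 >] && `[< B 1%N (branch_reward c) >].
    apply/asboolP/andP => [H|[/asboolP B0 /asboolP B1] [|[|t]]//].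
    by split; apply/asboolP; [exact: (H 0%N)|exact: (H 1%N)].
  by case: `[< B 0%N _ >]; case: `[< B 1%N _ >]; rewrite /= ?(mulr0, mul0r, mulr1, mul1r).
- rewrite [LHS](_ : _ = ((1 - p)%:E * path_law_from fork_mrp (Some None) [:: Some (Some c)] B)%E)//.
  rewrite law1 in_asboolE -EFinM /=; congr EFin.
  have -> : `[< forall t, (t < 1)%N -> B t (route_reward (false, c) t) >] =
      `[< B 0%N (branch_reward c) >].
    apply/asboolP/asboolP => [H|B0 [|t]//]; exact: (H 0%N).
  by case: `[< B 0%N _ >]; rewrite /= ?(mulr0, mulr1).
Qed.
End ForkProcess.

(** Rewards are compared only up to the last transition; a sample leaves the later ones
    arbitrary. *)
Definition follows (R : realType) (e : episode R fork_state) (w : bool * bool) :=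
  e.1 = route w /\
  forall t, (t < (size (route w)).-1)%N -> e.2 t = route_reward R w t.

(** * Means over finitely many independent draws *)

Section FiniteProductMean.
Context (R : comPzRingType) (T : finType) (q : T -> R).

(** Nested sums, one per draw, unfold by computation for n = 2 and n = 3, which a sum over a
    function space does not. *)
Fixpoint seq_mean (n : nat) (F : seq T -> R) : R :=
  if n is m.+1 then \sum_e q e * seq_mean m (fun l => F (e :: l)) else F [::].

Lemma seq_meanE n F :
  \sum_(w : {ffun 'I_n -> T}) (\prod_k q (w k)) * F [seq w k | k <- enum 'I_n] =
  seq_mean n F.
Proof.
elim: n F => [|n IHn] F /=.
  rewrite (big_pred1 [ffun i : 'I_0 => match (notF (valP i)) return T with end]).
    by rewrite big_ord0 mul1r enum_ord0.
  by move=> w; symmetry; apply/eqP/ffunP => -[].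
(* Prepending the first draw is a bijection from pairs onto outcomes of length n + 1. *)
pose ext (ew : T * {ffun 'I_n -> T}) : {ffun 'I_n.+1 -> T} :=
  [ffun i => if unlift ord0 i is Some j then ew.2 j else ew.1].
have ext0 ew : ext ew ord0 = ew.1 by rewrite ffunE unlift_none.
have extS ew j : ext ew (lift ord0 j) = ew.2 j by rewrite ffunE liftK.
rewrite (reindex ext)/=; last first.
  exists (fun w => (w ord0, [ffun j => w (lift ord0 j)])) => [[e w]|w] _ /=.
    by rewrite ext0; congr (_, _); apply/ffunP => j; rewrite ffunE extS.
  apply/ffunP => i; rewrite ffunE /=; case: unliftP => [j ->|->] //.
  by rewrite ffunE.
under [RHS]eq_bigr => e _ do rewrite -IHn mulr_sumr.
rewrite pair_bigA/=; apply: eq_bigr => -[e w] _ /=.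
rewrite big_ord_recl ext0 mulrA enum_ordSl /= ext0 -map_comp.
congr (_ * _ * F (_ :: _)); first by apply: eq_bigr => i _; rewrite extS.
by apply: eq_map => i /=; rewrite extS.
Qed.

Lemma ffun_prod_sum1 n : \sum_e q e = 1 ->
  \sum_(w : {ffun 'I_n -> T}) \prod_k q (w k) = 1.
Proof. by move=> q1; rewrite -(bigA_distr_bigA (fun _ => q)) big1. Qed.

End FiniteProductMean.

(** * Mean squared errors as finite sums *)

Section ForkSample.
Context (R : realType) (p : R) (p01 : 0 <= p <= 1) (n : nat).
Local Notation M := (fork_mrp p01).
Local Notation q := (route_prob p).

Section Mse.
Context d (Omega : measurableType d) (P : probability Omega R)
  (X : 'I_n -> Omega -> seq fork_state) (Y : 'I_n -> nat -> Omega -> R)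
  (XY : iid_sample M P X Y).

Lemma path_event_measurable k w (B : nat -> set R) :
  (forall t, measurable (B t)) -> measurable (path_event (X k) (Y k) w B).
Proof.
move=> mB; rewrite [path_event _ _ _ _](_ : _ = [set om | X k om = w] `&`
  \bigcap_(t in `I_(size w).-1) (Y k t @^-1` B t)); last by [].
apply: measurableI; first exact: sample_path_measurable XY _ _.
apply: bigcap_measurableType => t _; rewrite -[_ @^-1` _]setTI.
exact: (sample_reward_measurable XY).
Qed.

(** Almost surely every observed path follows some code, and the codes then determine the estimate,
    so the error is a finite mean over outcomes. *)
Lemma fork_mse (f : seq (episode R fork_state) -> R) (phi : seq (bool * bool) -> R) v :
  (forall (e : 'I_n -> episode R fork_state) (w : 'I_n -> bool * bool),
    (forall k, follows (e k) (w k)) ->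
    f [seq e k | k <- enum 'I_n] = phi [seq w k | k <- enum 'I_n]) ->
  mse P (fun om => f (observed X Y om)) v =
    (seq_mean q n (fun l => (phi l - v) ^+ 2))%:E.
Proof.
move=> fphi; rewrite /mse unlock -seq_meanE.
(* With singletons as reward sets, the cell [E w] says that each path k follows the code [w k]. *)
pose B (w : {ffun 'I_n -> bool * bool}) k t := [set route_reward R (w k) t].
pose E (w : {ffun 'I_n -> bool * bool}) := \bigcap_(k in [set k | k \in [set: 'I_n]%SET])
  path_event (X k) (Y k) (route (w k)) (B w k).
have mB (w : {ffun 'I_n -> bool * bool}) k t : measurable (B w k t) by exact: measurable_set1.
have PE w : P (E w) = (\prod_k q (w k))%:E.
  rewrite (sample_indep XY)// -prodEFin big_mkcond/=.
  apply: eq_bigr => k _; rewrite finset.in_setT (sample_law XY)// fork_path_law.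
  rewrite (bigD1 (w k))/=; last first.
    by rewrite /route_event eqxx; apply/asboolP.
  by rewrite big1 ?addr0// => e /andP[/andP[/eqP/route_inj -> _]]; rewrite eqxx.
rewrite (ge0_integral_finite_partition (E := E)
  (c := fun w => (phi [seq w k | k <- enum 'I_n] - v) ^+ 2)).
- rewrite -sumEFin; apply: eq_bigr => w _.
  by rewrite [RHS]EFinM muleC; congr mule; exact: PE.
- exact: probability_setT.
- move=> w; apply: fin_bigcap_measurable => // k _; exact: path_event_measurable.
- move=> w w' _ _ [om [Ew Ew']]; apply/ffunP => k; apply: route_inj.
  have [|<- _] := Ew k; first by rewrite /= finset.in_setT.
  by have [|<- _] := Ew' k; first by rewrite /= finset.in_setT.
- transitivity (\sum_(w : {ffun 'I_n -> bool * bool}) (\prod_k q (w k))%:E)%E.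
    by apply: eq_bigr => w _; exact: PE.
  by rewrite sumEFin ffun_prod_sum1// route_prob_sum1.
- by move=> om; rewrite sqr_ge0.
- by move=> w; rewrite sqr_ge0.
- move=> w om Ew; congr ((_ - v) ^+ 2); apply: fphi => k.
  by have [|] := Ew k; first by rewrite /= finset.in_setT.
Qed.
End Mse.
End ForkSample.

(** * Realisation of the sample on a discrete space *)

Section ForkSampleExists.
Context (R : realType) (p : R) (p01 : 0 <= p <= 1) (n : nat).
Local Notation q := (route_prob p).
Local Notation outcome := {ffun 'I_n -> bool * bool}.

Lemma outcome_prob_ge0 (w : outcome) : 0 <= \prod_k q (w k).
Proof. by apply: prodr_ge0 => k _; exact: route_prob_ge0. Qed.

(* The sample space is [nat], whose sigma-algebra is discrete: the number [i]
   stands for the i-th outcome. *)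
Definition outcome_of (i : nat) : outcome := nth [ffun=> (true, true)] (enum outcome) i.

(** A finite sum of weighted point masses is a measure by construction; numbers beyond the last
    outcome, where [outcome_of] takes its default, get no mass. *)
Definition fork_prob : set nat -> \bar R :=
  msum (fun i => mscale (NngNum (outcome_prob_ge0 (outcome_of i))) \d_i) #|outcome|.

HB.instance Definition _ := Measure.on fork_prob.

Lemma fork_probE A :
  fork_prob A = (\sum_(w : outcome | (enum_rank w : nat) \in A) \prod_k q (w k))%:E.
Proof.
rewrite [in RHS]big_mkcond -sumEFin [LHS](reindex (@enum_rank outcome))/=; last first.
  exact/onW_bij/enum_rank_bij.
apply: eq_bigr => w _; rewrite /mscale/= diracE.
rewrite /outcome_of -(enum_val_nth _ (enum_rank w)) enum_rankK.
by case: (_ \in _); rewrite (mule1, mule0).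
Qed.

Lemma fork_prob_setT : fork_prob setT = 1%E.
Proof.
rewrite fork_probE -[1%E]/(1%:E); congr EFin.
rewrite -[RHS](ffun_prod_sum1 n (route_prob_sum1 p)).
by apply: eq_bigl => w; rewrite in_setT.
Qed.

HB.instance Definition _ :=
  Measure_isProbability.Build _ _ _ fork_prob fork_prob_setT.

Definition fork_path (k : 'I_n) (i : nat) : seq fork_state := route (outcome_of i k).

Definition fork_path_reward (k : 'I_n) (t i : nat) : R :=
  route_reward R (outcome_of i k) t.

(** Serves twice: a singleton [J] gives the law of one path, and a general [J] then gives
    independence. *)
Lemma fork_prob_event (J : {set 'I_n}) (w : 'I_n -> seq fork_state)
    (B : 'I_n -> nat -> set R) :
  fork_prob (\bigcap_(k in [set k | k \in J])
    path_event (fork_path k) (fork_path_reward k) (w k) (B k)) =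
  (\prod_(k in J) \sum_(e | route_event (w k) (B k) e) q e)%:E.
Proof.
rewrite fork_probE; congr EFin.
under [RHS]eq_bigr => k _ do rewrite big_mkcond.
rewrite big_mkcond [RHS]big_mkcond/=.
(* Indices outside [J] contribute a factor 1, the sum over all codes; the product then runs over all
   k and distributes into a sum over outcomes. *)
transitivity (\prod_(k : 'I_n) \sum_e
  (if k \in J then (if route_event (w k) (B k) e then q e else 0) else q e)).
  rewrite bigA_distr_bigA/=; apply: eq_bigr => u _.
  have outcomeK : outcome_of (enum_rank u) = u.
    by rewrite /outcome_of -(enum_val_nth _ (enum_rank u)) enum_rankK.
  have evP k : (route_event (w k) (B k) (u k) : Prop) <->
      path_event (fork_path k) (fork_path_reward k) (w k) (B k) (enum_rank u).
    rewrite /path_event /fork_path /fork_path_reward /= outcomeK.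
    split=> [/andP[/eqP rw /asboolP]//|[rw ?]].
    by rewrite /route_event rw eqxx; apply/asboolP.
  case: ifPn => [|uN].
    rewrite inE => uJ; apply: eq_bigr => k _; case: ifPn => // kJ.
    by have /evP -> := uJ k kJ.
  (* An outcome outside the event fails at some index of [J], which makes its product 0. *)
  have [k kJ kN] : exists2 k, k \in J & ~~ route_event (w k) (B k) (u k).
    apply/exists_inP; rewrite -[X in is_true X]negbK negb_exists_in.
    apply: contra uN => /forall_inP uJ; rewrite inE => k kJ; apply/evP.
    by have := uJ k kJ; rewrite negbK.
  by rewrite (bigD1 k)//= kJ (negbTE kN) mul0r.
apply: eq_bigr => k _; case: ifPn => // _; exact: route_prob_sum1.
Qed.

Lemma fork_sample_exists : sample_exists (fork_mrp p01) n.
Proof.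
exists _, nat, fork_prob, fork_path, fork_path_reward.
have law k w B : fork_prob (path_event (fork_path k) (fork_path_reward k) w B) =
    (\sum_(e | route_event w B e) q e)%:E.
  have := fork_prob_event [set k] (fun=> w) (fun=> B).
  rewrite big_set1 => <-; congr fork_prob.
  apply/seteqP; split => [i wi k'|i]/=; first by rewrite finset.in_set1 => /eqP ->.
  by apply; rewrite /= finset.in_set1.
split => //.
- by move=> k w B _; rewrite [RHS]fork_path_law; exact: law.
- move=> J w B _; rewrite [LHS]fork_prob_event -prodEFin.
  by apply: eq_bigr => k _; exact/esym/law.
Qed.
End ForkSampleExists.

(** * The estimators as functions of the codes *)

Section ForkEstimators.
Context (R : realType).
Implicit Types (e : episode R fork_state) (w : bool * bool).

(** The discount is 1 and the transition from s to x pays 0, so the return from s is the branch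
    reward; paths starting in x do not visit s. *)
Definition mc_route (ws : seq (bool * bool)) : R :=
  (\sum_(w <- ws | w.1) branch_reward R w.2) / (count fst ws)%:R.

(* The values and visit counts of [None] and [Some None]; the estimates of the
   terminal states stay 0. *)
Definition td_route_step (l : R) (a : fork_state -> nat -> R)
    (st : (R * R) * (nat * nat)) w : (R * R) * (nat * nat) :=
  let: ((v0, v1), (n0, n1)) := st in
  let g := branch_reward R w.2 in
  let v1' := (1 - a (Some None) n1.+1) * v1 + a (Some None) n1.+1 * g in
  if w.1 then
    ((1 - a None n0.+1) * v0 +
       a None n0.+1 * (l * g + (1 - l) * (if n1 == 0 then v1' else v1)), v1',
     (n0.+1, n1.+1))
  else ((v0, v1'), (n0, n1.+1)).

Definition td_route l a ws : R := (foldl (td_route_step l a) ((0, 0), (0, 0)) ws).1.1.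

Lemma mc_follows I (s : seq I) (e : I -> episode R fork_state) (w : I -> bool * bool) :
  (forall k, follows (e k) (w k)) ->
  mc 1 None [seq e k | k <- s] = mc_route [seq w k | k <- s].
Proof.
move=> ew; rewrite /mc /mc_route; congr (_ / _%:R).
  rewrite !big_map; apply: eq_big => k; have [e1 e2] := ew k.
    by rewrite e1 /route; case: (w k) => -[] [].
  rewrite /first_visit_return e1.
  case: (w k) e2 => -[] c e2 //= _; rewrite ?eqE/= !big_nat_recr//= !big_geq//= !e2//=.
  by rewrite !expr1n /route_reward/=; lra.
rewrite !count_map; apply: eq_count => k /=; have [e1 _] := ew k.
by rewrite e1 /route; case: (w k) => -[] [].
Qed.

(** As terminal estimates are 0, the target is g for x and l g + (1 - l) U(x) for s, with g the
    branch reward and U(x) the old estimate of x, or the new one at its first visit. *)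
Lemma td_path_follows l a V N e w v0 v1 n0 n1 :
  follows e w -> (forall c, V (Some (Some c)) = 0) ->
  V None = v0 -> V (Some None) = v1 -> N None = n0 -> N (Some None) = n1 ->
  let V' := td_path 1 l a V N e.1 e.2 in
  [/\ V' None = (td_route_step l a ((v0, v1), (n0, n1)) w).1.1,
   V' (Some None) = (td_route_step l a ((v0, v1), (n0, n1)) w).1.2 &
   forall c, V' (Some (Some c)) = 0].
Proof.
move=> + V0 E0 E1 E2 E3; subst v0 v1 n0 n1.
case: w => -[] c [/= -> e2].
- rewrite /route /= /td_target ?eqE/= !big_nat_recr//= !big_geq//= !e2//= /route_reward/=.
  rewrite !V0 !(mulr0, addr0, add0r, if_same, mul1r, expr0, expr1).
  by split=> // *; rewrite ?V0 ?if_same.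
- rewrite /route /= /td_target ?eqE/= !big_nat_recr//= !big_geq//= !e2//= /route_reward/=.
  rewrite !V0 !(mulr0, addr0, add0r, if_same, mul1r, expr0, expr1).
  by split=> // *; rewrite ?V0 ?if_same.
Qed.

Lemma td_follows l a I (s : seq I) (e : I -> episode R fork_state) (w : I -> bool * bool) :
  (forall k, follows (e k) (w k)) ->
  td 1 l a None [seq e k | k <- s] = td_route l a [seq w k | k <- s].
Proof.
move=> ew; rewrite /td /td_route.
(* Both initial learner states are named so that the induction can generalise over them; it keeps
   them in agreement and the terminal estimates at 0. *)
set st : (fork_state -> R) * (fork_state -> nat) := (_, _).
set vn : (R * R) * (nat * nat) := ((_, _), _).
have st0 c : st.1 (Some (Some c)) = 0 by [].
have : [/\ st.1 None = vn.1.1, st.1 (Some None) = vn.1.2,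
  st.2 None = vn.2.1 & st.2 (Some None) = vn.2.2] by [].
elim: s st vn st0 => [|k s IHs] [V N] [[v0 v1] [n0 n1]] V0 [/= E0 E1 E2 E3] //=.
have [D0 D1 D2] := td_path_follows l a (ew k) V0 E0 E1 E2 E3.
apply: IHs => //; split=> //=; rewrite ?E2 ?E3.
- by have [-> _] := ew k; case: (w k) => -[] c; rewrite /= ?inE/= ?addn1 ?addn0.
- by have [-> _] := ew k; case: (w k) => -[] c; rewrite /= ?inE/= ?addn1 ?addn0.
Qed.
End ForkEstimators.

Lemma sum_bool_pair (V : nmodType) (F : bool * bool -> V) :
  \sum_e F e = F (true, true) + F (true, false) + (F (false, true) + F (false, false)).
Proof.
transitivity (\sum_e F (e.1, e.2)); first by apply: eq_bigr => -[].
by rewrite -(pair_bigA _ (fun b c => F (b, c)))/= !big_bool.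
Qed.

(** * The four errors *)

Section ForkErrors.
Context (R : realType).

Lemma mc_error2 : seq_mean (@route_prob R 1) 2 (fun ws => (mc_route R ws - 0) ^+ 2) = 1 / 2.
Proof.
rewrite /= !sum_bool_pair /mc_route /route_prob /branch_reward [bigop]unlock /=.
by rewrite !(addn0, add0n, addn1, mul0r); lra.
Qed.

(** First rates 1 make both estimates G1 after one path. The second path updates s with the target l
    G2 + (1 - l) G1, since x still counts with its old estimate. *)
Lemma td_error2 l (a : fork_state -> nat -> R) : learning_rates a ->
  seq_mean (@route_prob R 1) 2 (fun ws => (td_route l a ws - 0) ^+ 2) =
    (1 - a None 2%N * l) ^+ 2 + (a None 2%N * l) ^+ 2.
Proof.
move=> ra; have [a0 _] := ra None; have [a1 _] := ra (Some None).
rewrite /= !sum_bool_pair /td_route /route_prob /branch_reward /= a0 a1.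
by field.
Qed.

(** Given K visits to s, the average of K independent signs has mean square 1 / K, or 0 if K = 0; K
    is binomial with parameters 3 and 1/4. *)
Lemma mc_error3 : seq_mean (@route_prob R (1 / 4)) 3
  (fun ws => (mc_route R ws - 0) ^+ 2) = 191 / 384.
Proof.
rewrite /= !sum_bool_pair /mc_route /route_prob /branch_reward [bigop]unlock /=.
by rewrite !(addn0, add0n, addn1, add1n, mul0r); lra.
Qed.

(** The estimate of x is the average of its returns so far, so s has targets G1, G1, (G1 + G2) / 2
    in paths 1, 2, 3, averaged over the paths that start in s. *)
Lemma td_error3 : seq_mean (@route_prob R (1 / 4)) 3
  (fun ws => (td_route 0 (@harmonic_rates R fork_state) ws - 0) ^+ 2) = 1079 / 2304.
Proof.
rewrite /= !sum_bool_pair /td_route /harmonic_rates /route_prob /branch_reward /=.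
by field.
Qed.
End ForkErrors.

Theorem mainTheorem10 (R : realType) :
  (exists (S : finType) (M : mrp R S) (V : S -> R) (s : S) (n : nat),
     [/\ acyclic M, is_value M V, sample_exists M n &
       forall (d : measure_display) (Omega : measurableType d)
         (P : probability Omega R) (X : 'I_n -> Omega -> seq S)
         (Y : 'I_n -> nat -> Omega -> R),
       iid_sample M P X Y ->
       forall a : S -> nat -> R, learning_rates a ->
       (mse P (fun om => mc (disc M) s (observed X Y om)) (V s) <
        mse P (fun om => td (disc M) 0 a s (observed X Y om)) (V s))%E /\
       (forall l : R, 0 <= l <= 1 ->
        (mse P (fun om => mc (disc M) s (observed X Y om)) (V s) <=
         mse P (fun om => td (disc M) l a s (observed X Y om)) (V s))%E)]) /\
  (exists (S : finType) (M : mrp R S) (V : S -> R) (s : S) (n : nat),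
     [/\ acyclic M, is_value M V, sample_exists M n &
       forall (d : measure_display) (Omega : measurableType d)
         (P : probability Omega R) (X : 'I_n -> Omega -> seq S)
         (Y : 'I_n -> nat -> Omega -> R),
       iid_sample M P X Y ->
       (mse P (fun om =>
            td (disc M) 0 (@harmonic_rates R S) s (observed X Y om)) (V s) <
        mse P (fun om => mc (disc M) s (observed X Y om)) (V s))%E]).
Proof.
have p1 : 0 <= (1 : R) <= 1 by rewrite ler01 lexx.
(* TD(0) gains only if the third path alone visits s (error 1/2 against 1) and loses when s is
   visited several times; a small p makes the gain prevail. *)
have p4 : 0 <= (1 / 4 : R) <= 1 by apply/andP; split; lra.
split.
  exists fork_state, (fork_mrp p1), (fun=> 0), None, 2%N; split.
  - exact: fork_acyclic.
  - exact: fork_value.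
  - exact: fork_sample_exists.
  move=> d Omega P X Y XY a ra.
  rewrite (fork_mse XY _ (fun e w => @mc_follows R _ (enum 'I_2) e w)) mc_error2.
  have tdE l : mse P (fun om => td (disc (fork_mrp p1)) l a None (observed X Y om)) 0 =
      ((1 - a None 2%N * l) ^+ 2 + (a None 2%N * l) ^+ 2)%:E.
    rewrite -td_error2//.
    exact: (fork_mse XY _ (fun e w => @td_follows R l a _ (enum 'I_2) e w)).
  split=> [|l _]; rewrite tdE; first by rewrite lte_fin; lra.
  (* With u = l alpha_2, (1 - u)^2 + u^2 - 1/2 = (2u - 1)^2 / 2. *)
  by rewrite lee_fin; have := sqr_ge0 (2 * (a None 2%N * l) - 1); lra.
exists fork_state, (fork_mrp p4), (fun=> 0), None, 3%N; split.
- exact: fork_acyclic.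
- exact: fork_value.
- exact: fork_sample_exists.
move=> d Omega P X Y XY.
rewrite (fork_mse XY _ (fun e w => @td_follows R 0 (@harmonic_rates R fork_state) _ (enum 'I_3) e w)).
rewrite (fork_mse XY _ (fun e w => @mc_follows R _ (enum 'I_3) e w)).
by rewrite td_error3 mc_error3 lte_fin; lra.
Qed.
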